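(* If $\Delta\subset M_{\mathbb R}$ is a $\mathbb{Q}$-reflexive polytope, then $\Delta^\circ=(\mathrm{Conv}(\Delta\cap M))^*\subset N_{\mathbb R}$ is $\mathbb{Q}$-reflexive (with respect to $N$), and the map $\Delta\mapsto\Delta^\circ$ is an involution on the set of $\mathbb{Q}$-reflexive polytopes, i.e. $(\Delta^\circ)^\circ=\Delta$.
   Context: $M$ is a lattice of rank $d$, $N=\mathrm{Hom}(M,\mathbb Z)$ its dual lattice with the natural pairing $\langle\cdot,\cdot\rangle$, $M_{\mathbb R}=M\otimes\mathbb R$, $N_{\mathbb R}=N\otimes\mathbb R$. For a subset $P\subset M_{\mathbb R}$, $P^*=\{n\in N_{\mathbb R}\mid \langle m,n\rangle\ge-1\ \forall m\in P\}$ (and symmetrically for subsets of $N_{\mathbb R}$). A $d$-dimensional polytope $\Delta\subset M_{\mathbb R}$ is $\mathbb{Q}$-reflexive (with respect to $M$) if $0\in\mathrm{int}(\Delta)$ and $\mathrm{Conv}\big((\mathrm{Conv}(\Delta\cap M))^*\cap N\big)=\Delta^*$. The same notion is used in $N_{\mathbb R}$ with $M$ and $N$ exchanged; for $\Delta'\subset N_{\mathbb R}$, $(\Delta')^\circ=(\mathrm{Conv}(\Delta'\cap N))^*\subset M_{\mathbb R}$. *)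

(* Defs.v *)
From HB Require Import structures.
From mathcomp Require Import all_boot all_order all_algebra.
From mathcomp Require Import all_classical all_reals all_analysis.
Import Order.TTheory GRing.Theory Num.Theory.
Import numFieldNormedType.Exports.

Set Implicit Arguments.
Unset Strict Implicit.
Unset Printing Implicit Defensive.

Local Open Scope classical_set_scope.
Local Open Scope ring_scope.

(* M_R is an arbitrary finite-dimensional real vector space V and M is a
   lattice of full rank in V, so that M (x) R = V canonically.  N_R is the
   algebraic dual of V and N the set of functionals that are integral on M,
   which restriction to M identifies with Hom(M, Z). *)

Section Lattices.
Context {R : realType} {V : vectType R}.

Definition is_lattice (d : nat) (M : set V) : Prop :=
  exists2 e : d.-tuple V, basis_of fullv e
    & M = [set \sum_(i < d) e`_i *~ z i | z in [set: 'I_d -> int]].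

Definition dual_lattice (M : set V) : set 'Hom(V, R^o) :=
  [set n | forall m, M m -> (n m : R) \is a Num.int].

Definition pairing (m : V) (n : 'Hom(V, R^o)) : R := n m.

Definition copairing (n : 'Hom(V, R^o)) (m : V) : R := pairing m n.

End Lattices.

Section Polytopes.
Context {R : realType} {V : vectType R}.

Definition conv_hull (A : set V) : set V :=
  smallest (@convex_set R V) A.

(* The dimension of a polytope is that of its affine span, whose direction is
   spanned by the differences x - x0. *)
Definition is_polytope (k : nat) (P : set V) : Prop :=
  exists (x0 : V) (s : seq V),
    P = conv_hull [set` x0 :: s] /\ \dim <<[seq x - x0 | x <- s]>>%VS = k.

(* A vectType carries no topology: the interior is taken in the coordinates of
   a basis of V, and does not depend on the basis. *)
Definition vinterior (A : set V) : set V :=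
  let e := vbasis (fullv : {vspace V}) in
  [set x | interior (passmx.vecof e @^-1` A) (passmx.rVof e x)].

End Polytopes.

(* The pairing b is a parameter, so that the roles of M_R and N_R can be
   exchanged. *)
Section QReflexive.
Context {R : realType} {V W : vectType R}.

Definition polar (b : V -> W -> R) (P : set V) : set W :=
  [set n | forall m, P m -> -1 <= b m n].

Definition circ (b : V -> W -> R) (M : set V) (P : set V) : set W :=
  polar b (conv_hull (P `&` M)).

Definition Qreflexive (b : V -> W -> R) (M : set V) (N : set W)
    (P : set V) : Prop :=
  [/\ is_polytope (\dim (fullv : {vspace V})) P,
      vinterior P 0
    & conv_hull (circ b M P `&` N) = polar b P].

End QReflexive.

(* Main.v *)
Require Import Defs.
From mathcomp Require Import all_boot all_order all_algebra.
From mathcomp Require Import all_classical all_reals all_analysis.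
From mathcomp Require Import ring lra zify.
Import Order.TTheory GRing.Theory Num.Theory.
Import numFieldNormedType.Exports.

(** Let D be Q-reflexive and P := conv (D ∩ M), so that the dual of D is P^*.

    Since D is bounded, D ∩ M is finite and P is a polytope containing 0.  By
    hypothesis conv (P^* ∩ N) = D^*, hence the dual of the dual of D is D^** = D
    by the bipolar theorem; and then conv (D^** ∩ M) = P = P^**, again by the
    bipolar theorem, which is the equation making P^* Q-reflexive.  The bipolar
    theorem [bipolar_conv] rests on Farkas' lemma [farkas].

    What remains is that P^* is a full-dimensional polytope with 0 in its
    interior.  The interior point is clear, as P is generated by finitely many
    points.  The substance is that P^* is bounded, i.e. that no nonzero w is
    nonnegative on D ∩ M.  If some w were, Dirichlet approximation of a large
    multiple of w would yield a lattice point n whose values on the finite set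
    D ∩ M exceed -1; these values are integers, so n is itself nonnegative on
    D ∩ M ([lattice_point_in_cone]).  Then all multiples of n are in
    P^* ∩ N, hence in D^*, which is impossible since D contains points in
    every direction ([Qreflexive_no_recession]).  Once P^* is bounded, it is the
    convex hull of its vertices ([polar_finite_conv]).

    Everything is carried out for a bilinear pairing of two spaces V and W with
    dual bases, a setting symmetric in V and W ([dual_lattices_flip]), so that
    the two halves of the theorem are one statement, [Qreflexive_circ]. *)

Set Implicit Arguments.
Unset Strict Implicit.
Unset Printing Implicit Defensive.

Local Open Scope classical_set_scope.
Local Open Scope ring_scope.

(** * Convex hulls *)

Section ConvexHull.
Context {R : realType} {V : vectType R}.
Implicit Types (A K : set V).

Definition segment_closed K := forall (t : R) x y,
  0 <= t <= 1 -> K x -> K y -> K (t *: x + (1 - t) *: y).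

Lemma convex_setE K : @convex_set R V K <-> segment_closed K.
Proof.
split=> [cK t x y /andP[t0 t1] Kx Ky|cK x y t].
  have /(_ (mem_set Kx) (mem_set Ky)) := cK x y (Itv01 t0 t1).
  by rewrite inE.
rewrite !inE => Kx Ky; apply: (cK t%:inum) => //.
by apply/andP; split; [exact: ge0|exact: le1].
Qed.

Lemma sub_conv_hull A : A `<=` conv_hull A.
Proof. exact: sub_gen_smallest. Qed.

Lemma conv_hull_sub A K : segment_closed K -> A `<=` K -> conv_hull A `<=` K.
Proof. by move=> /convex_setE cK AK; apply: smallest_sub. Qed.

Lemma conv_hull_segment A : segment_closed (conv_hull A).
Proof.
move=> t x y t01 Ax Ay K [cK AK]; have /convex_setE := cK; apply => //.
- exact: Ax.
- exact: Ay.
Qed.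

End ConvexHull.

(** * Bilinear pairings and Farkas' lemma *)

Section Pairing.
Context {R : realType}.

Record bilinear_pairing (V W : lmodType R) (b : V -> W -> R) : Prop := {
  pair_linl : forall a x y w, b (a *: x + y) w = a * b x w + b y w ;
  pair_linr : forall a v x y, b v (a *: x + y) = a * b v x + b v y }.

Definition flip (V W : Type) (b : V -> W -> R) := fun w v => b v w.

Lemma flip_pairing (V W : lmodType R) (b : V -> W -> R) :
  bilinear_pairing b -> bilinear_pairing (flip b).
Proof. by case=> l r; split=> *; [exact: r|exact: l]. Qed.

Section Theory.
Context {V W : lmodType R} {b : V -> W -> R} (bb : bilinear_pairing b).

Lemma pair0l w : b 0 w = 0.
Proof. by have := pair_linl bb (-1) 0 0 w; rewrite scaler0 addr0; lra. Qed.

Lemma pairDl x y w : b (x + y) w = b x w + b y w.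
Proof. by rewrite -[x in LHS]scale1r (pair_linl bb) mul1r. Qed.

Lemma pairZl a x w : b (a *: x) w = a * b x w.
Proof. by rewrite -[a *: x]addr0 (pair_linl bb) pair0l addr0. Qed.

End Theory.

Section TheoryR.
Context {V W : lmodType R} {b : V -> W -> R} (bb : bilinear_pairing b).
Let fb := flip_pairing bb.

Lemma pair0r v : b v 0 = 0.
Proof. exact: (pair0l fb). Qed.

Lemma pairDr v x y : b v (x + y) = b v x + b v y.
Proof. exact: (pairDl fb). Qed.

Lemma pairZr a v x : b v (a *: x) = a * b v x.
Proof. exact: (pairZl fb). Qed.

Lemma pair_suml I (r : seq I) (P : pred I) (F : I -> V) w :
  b (\sum_(i <- r | P i) F i) w = \sum_(i <- r | P i) b (F i) w.
Proof.
apply: (big_morph (b ^~ w)) => [x y|]; [exact: pairDl|exact: pair0l].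
Qed.

End TheoryR.

Lemma pair_sumr (V W : lmodType R) (b : V -> W -> R) (bb : bilinear_pairing b)
    I (r : seq I) (P : pred I) (F : I -> W) v :
  b v (\sum_(i <- r | P i) F i) = \sum_(i <- r | P i) b v (F i).
Proof. exact: (pair_suml (flip_pairing bb)). Qed.

Definition convex_cone (V : lmodType R) (K : set V) :=
  [/\ K 0, forall x y, K x -> K y -> K (x + y)
    & forall a x, 0 <= a -> K x -> K (a *: x)].

(** Induction on the number of generators.  If the hypothesis on [c] already
    holds with the tail [s], there is nothing to do; otherwise some [w0] is
    nonnegative on [s] and negative on [c], hence negative on [a].  Subtracting
    multiples of [a] from the vectors so as to annihilate [w0] only moves them
    within [K], and reduces the claim to a family with one generator fewer.
    Stating the conclusion for an arbitrary cone [K] avoids handling explicit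
    nonnegative combinations. *)
Lemma farkas (V W : lmodType R) (b : V -> W -> R) (s : seq V) (c : V)
    (K : set V) :
  bilinear_pairing b -> (forall v, (forall w, b v w = 0) -> v = 0) ->
  convex_cone K -> [set` s] `<=` K ->
  (forall w, (forall m, m \in s -> 0 <= b m w) -> 0 <= b c w) ->
  K c.
Proof.
move=> bb nd [K0 KD KZ].
have [n] := ubnP (size s); elim: n s c => // n IH [|a s] c /= sn sK cs.
  suff -> : c = 0 by [].
  apply: nd => w; have := cs w; have := cs (-1 *: w).
  rewrite (pairZr bb) => /(_ (fun _ => ltac:(done))) h1.
  by move=> /(_ (fun _ => ltac:(done))) h2; lra.
have [h|/existsNP[w0 /not_implyP[sw0 /negP]]] := pselect
  (forall w, (forall m, m \in s -> 0 <= b m w) -> 0 <= b c w).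
  by apply: (IH s) => // x xs; apply: sK; rewrite /= inE xs orbT.
rewrite -ltNge => cw0.
have aw0 : b a w0 < 0.
  rewrite ltNge; apply/negP => aw0; have := cs w0; rewrite leNgt cw0 => h.
  have : false by apply: h => m; rewrite inE => /predU1P[->|/sw0].
  by [].
pose w1 := (- b a w0)^-1 *: w0.
have k0 : 0 < (- b a w0)^-1 by rewrite invr_gt0 oppr_gt0.
have aw1 : b a w1 = -1.
  by rewrite (pairZr bb) invrN mulNr mulVf // lt_eqF.
have Ka : K a by apply: sK; rewrite /= mem_head.
have -> : c = (c + b c w1 *: a) + (- b c w1) *: a.
  by rewrite -addrA -scalerDl subrr scale0r addr0.
apply: (KD); last first.
  by apply: (KZ) => //; rewrite (pairZr bb) -mulrN mulr_ge0 ?ltW// oppr_gt0.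
(* Adjoint to the projection x |-> x + b x w1 *: a is the map
   w |-> w + b a w *: w1, whose values are orthogonal to [a]; so the
   projected family inherits the hypothesis. *)
pose t := [seq x + b x w1 *: a | x <- s].
have bt x w : b (x + b x w1 *: a) w = b x (w + b a w *: w1).
  by rewrite (pairDl bb) (pairZl bb) (pairDr bb) (pairZr bb (b a w)) mulrC.
apply: (IH t); first by rewrite size_map.
  move=> _ /= /mapP[x xs ->]; apply: (KD).
    by apply: sK; rewrite /= inE xs orbT.
  by apply: (KZ) => //; rewrite (pairZr bb) mulr_ge0 ?(ltW k0)// sw0.
move=> w tw; rewrite bt; apply: cs => m; rewrite inE => /predU1P[->|ms].
  by rewrite (pairDr bb) (pairZr bb) aw1 mulrN1 subrr.
by rewrite -bt; apply: tw; apply/mapP; exists m.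
Qed.
End Pairing.

(** * Polars of finitely generated convex sets *)

Lemma polar_segment_closed (R : realType) (V W : vectType R) (b : V -> W -> R)
    (P : set V) : bilinear_pairing b -> segment_closed (polar b P).
Proof.
move=> bb t x y t01 Px Py m Pm; rewrite (pairDr bb) !(pairZr bb).
by have := Px m Pm; have := Py m Pm; nra.
Qed.

Section Polar.
Context {R : realType} {V W : vectType R} {b : V -> W -> R}.
Hypothesis bb : bilinear_pairing b.

Lemma polar_conv_hull (P : set V) : polar b (conv_hull P) = polar b P.
Proof.
apply/seteqP; split=> w Pw m Pm; first by apply: Pw; exact: sub_conv_hull.
suff /(_ m Pm) : conv_hull P `<=` [set v | -1 <= b v w] by [].
apply: conv_hull_sub => // t x y t01 /= hx hy.
by rewrite (pairDl bb) !(pairZl bb); nra.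
Qed.

(** An affine function v |-> b v w + t is the pairing of the point (v, 1) at
    height 1 with (w, t); this turns statements on convex hulls into statements
    on cones. *)
Definition homog_pairing (p : V * R^o) (q : W * R^o) : R :=
  b p.1 q.1 + p.2 * q.2.

Lemma homog_pairing_bilinear : bilinear_pairing homog_pairing.
Proof.
split=> [a p q w|a w p q]; rewrite /homog_pairing /=.
  by rewrite (pair_linl bb) /GRing.scale /=; ring.
by rewrite (pair_linr bb) /GRing.scale /=; ring.
Qed.

(** Farkas' lemma is applied to the points (m, 1) for m in [s] and to (x, 1).  An
    affine form b _ w + t nonnegative on [s] has t >= 0 because 0 lies in the
    hull; if t > 0 then t^-1 *: w is in the polar, and if t = 0 then every
    positive multiple of [w] is.  In both cases the form is nonnegative at
    [x]. *)
Lemma bipolar_conv (s : seq V) : (forall v, (forall w, b v w = 0) -> v = 0) ->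
  conv_hull [set` s] 0 -> polar (flip b) (polar b [set` s]) = conv_hull [set` s].
Proof.
move=> nd s0; apply/seteqP; split=> [x xP|]; last first.
  apply: conv_hull_sub => [|m ms w]; last exact.
  exact/polar_segment_closed/flip_pairing.
(* the cone over the hull placed at height 1; its slice at height 0 is {0} *)
pose K := [set p : V * R^o |
  exists2 y, conv_hull [set` s] y & 0 <= p.2 /\ p.1 = p.2 *: y].
suff [y sy /= [_]] : K (x, 1) by rewrite scale1r => ->.
apply: (@farkas _ _ _ homog_pairing [seq (m, 1) | m <- s]).
- exact: homog_pairing_bilinear.
- move=> [v r] h; congr pair.
    apply: nd => w; have := h (w, 0).
    by rewrite /homog_pairing /= mulr0 addr0.
  by have := h (0, 1); rewrite /homog_pairing /= (pair0r bb) add0r mulr1.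
- split; first by exists 0 => //=; rewrite scaler0.
    (* a sum of points at heights r1, r2 lies over the weighted mean *)
    move=> [v1 r1] [v2 r2] [y1 sy1 /= [r10 ->]] [y2 sy2 /= [r20 ->]].
    have [r0|r0] := eqVneq (r1 + r2) 0.
      have -> : r1 = 0 by lra.
      have -> : r2 = 0 by lra.
      by exists 0 => //=; rewrite addr0 lexx !scale0r addr0.
    have r12 : 0 < r1 + r2 by rewrite lt_def r0 addr_ge0.
    exists ((r1 / (r1 + r2)) *: y1 + (1 - r1 / (r1 + r2)) *: y2) => /=.
      apply: conv_hull_segment => //.
      apply/andP; split; first exact: (divr_ge0 r10 (ltW r12)).
      by rewrite (ler_pdivrMr _ _ r12) mul1r lerDl.
    split; first exact: ltW.
    rewrite scalerDr !scalerA mulrBr mulr1 mulrC divfK //.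
    by rewrite [r1 + r2]addrC addrK.
  move=> a [v r] a0 [y sy /= [r0 ->]]; exists y => //=.
  by rewrite scalerA mulr_ge0.
- by move=> _ /= /mapP[m ms ->]; exists m; [exact: sub_conv_hull|rewrite scale1r].
move=> [w t] h; rewrite /homog_pairing /= mul1r.
have {}h m : conv_hull [set` s] m -> 0 <= b m w + t.
  suff : conv_hull [set` s] `<=` [set v | 0 <= b v w + t] by apply.
  apply: conv_hull_sub => [u v1 v2 u01 /= h1 h2|v sv].
    by rewrite (pairDl bb) !(pairZl bb); nra.
  have /= := h (v, 1); rewrite /homog_pairing /= mul1r; apply.
  by apply/mapP; exists v.
have t0 : 0 <= t by have := h 0 s0; rewrite (pair0l bb) add0r.
have scaled k : 0 <= k -> k * t <= 1 -> -1 <= k * b x w.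
  move=> k0 kt; have := xP (k *: w); rewrite /flip (pairZr bb); apply=> m ms.
  rewrite (pairZr bb).
  by have := h m (sub_conv_hull ms); nra.
have [tE|tN] := eqVneq t 0.
  rewrite tE addr0 leNgt; apply/negP => xw.
  (* any factor k with k * b x w < -1 contradicts [scaled] *)
  have := scaled (2 / - b x w); rewrite tE mulr0 => /(_ _ ler01).
  rewrite invrN mulrN mulNr divfK ?lt_eqF//.
  have : 0 <= - (2 / b x w) by rewrite -mulrN -invrN divr_ge0 // oppr_ge0 ltW.
  by move=> k0 /(_ k0); lra.
have tp : 0 < t by rewrite lt_def tN.
have := scaled t^-1; rewrite mulVf // invr_ge0 => /(_ t0 (lexx _)).
by rewrite mulrC ler_pdivlMr // mulN1r; lra.
Qed.

(** A polyhedron without recession direction is the convex hull of its vertices,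
    the points determined by the inequalities that are tight there.  If [w] is
    not a vertex, a line through [w] along which the tight inequalities stay
    tight leaves the polyhedron at both ends; [w] lies between the two exit
    points, and each of these has more tight inequalities. *)
Lemma polar_finite_conv (s : seq V) :
  (forall w, (forall m, m \in s -> 0 <= b m w) -> w = 0) ->
  exists t : seq W, polar b [set` s] = conv_hull [set` t].
Proof.
move=> norec; pose n := size s.
pose a (i : 'I_n) : V := s`_i.
have polarE w : polar b [set` s] w <-> forall i, -1 <= b (a i) w.
  split=> [h i|h m ms]; first by apply: h; exact: mem_nth.
  by have := h (Ordinal (etrans (index_mem m s) ms)); rewrite /a /= nth_index.
pose tight w := [set i | b (a i) w == -1]%SET.
pose rigid (J : {set 'I_n}) :=
  forall u, (forall i, i \in J -> b (a i) u = 0) -> u = 0.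
pose vertex (J : {set 'I_n}) : W :=
  xget 0 [set w | [/\ polar b [set` s] w, tight w = J & rigid J]].
exists [seq vertex J | J <- enum {: {set 'I_n}}].
apply/seteqP; split; last first.
  apply: conv_hull_sub; first exact: polar_segment_closed.
  move=> _ /= /mapP[J _ ->]; rewrite /vertex.
  (* when [J] defines no vertex, [vertex J] is 0, which is in the polar *)
  case: xgetP => [w _ []//|_].
  by apply/polarE => i; rewrite (pair0r bb) lerN10.
have exit w u : polar b [set` s] w -> u != 0 ->
    (forall i, i \in tight w -> b (a i) u = 0) ->
    exists t, [/\ 0 < t, polar b [set` s] (w + t *: u) &
      (#|tight w| < #|tight (w + t *: u)%R|)%N].
  move=> /polarE wP u0 uT.
  have [i0 i0P] : exists i, b (a i) u < 0.
    apply/not_existsP => h; move/negP: u0; apply; apply/eqP/norec => m ms.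
    have := h (Ordinal (etrans (index_mem m s) ms)).
    by rewrite /a /= nth_index // => /negP; rewrite -leNgt.
  (* the parameter at which inequality i becomes tight; the least one is the
     exit time *)
  pose F i := (b (a i) w + 1) / - b (a i) u.
  have [i iP imin] := @Order.TotalTheory.arg_minP _ _ _ i0
    (fun i => b (a i) u < 0) F i0P.
  have iN : i \notin tight w by apply/negP => /uT h; move: iP; rewrite h ltxx.
  have wi : 0 < b (a i) w + 1.
    by move: iN (wP i); rewrite inE; lra.
  have Fi : F i * b (a i) u = - (b (a i) w + 1).
    by rewrite /F invrN mulrN mulNr divfK // lt_eqF.
  have F0 : 0 < F i by rewrite divr_gt0 // oppr_gt0.
  exists (F i); split=> //.
    apply/polarE => j; rewrite (pairDr bb) (pairZr bb).
    have := wP j; have [ju|ju] := ltP (b (a j) u) 0; last by nra.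
    have := imin j ju; rewrite {2}/F ler_pdivlMr ?oppr_gt0//; lra.
  apply: proper_card; apply/properP; split.
    apply/fintype.subsetP => j jT; move: (jT); rewrite !inE.
    rewrite (pairDr bb) (pairZr bb).
    by rewrite (uT j jT) mulr0 addr0.
  exists i => //; rewrite inE (pairDr bb) (pairZr bb) Fi; apply/eqP; ring.
move=> w; have [k] := ubnP (n - #|tight w|)%N.
elim: k w => // k IH w wk wP.
have [rw|/existsNP[u /not_implyP[uT /eqP u0]]] := pselect (rigid (tight w)).
  suff -> : w = vertex (tight w).
    by apply: sub_conv_hull; apply/mapP; exists (tight w); rewrite ?mem_enum.
  rewrite /vertex; case: xgetP => [v _ [vP vT _]|/(_ w)]; last by case.
  apply/eqP; rewrite -subr_eq0; apply/eqP; apply: rw => i iT.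
  rewrite -scaleN1r (pairDr bb) (pairZr bb).
  have := iT; rewrite -vT inE => /eqP ->.
  by move: iT; rewrite inE => /eqP ->; rewrite mulN1r subrr.
have rec t v : 0 < t -> polar b [set` s] (w + t *: v) ->
    (#|tight w| < #|tight (w + t *: v)%R|)%N ->
    conv_hull [set` [seq vertex J | J <- enum {: {set 'I_n}}]] (w + t *: v).
  move=> t0 vP vT; apply: IH => //.
  have vn := max_card (mem (tight (w + t *: v)%R)); rewrite card_ord in vn.
  move: wk; rewrite ltnS; apply: leq_trans.
  by rewrite ltn_sub2l // (leq_trans vT).
have [t1 [t10 P1 T1]] := exit w u wP u0 uT.
have uN0 : - u != 0 by rewrite oppr_eq0.
have [t2 [t20 P2 T2]] : exists t, [/\ 0 < t, polar b [set` s] (w + t *: (- u)) &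
      (#|tight w| < #|tight (w + t *: (- u))%R|)%N].
  apply: exit => // i iT.
  by rewrite -scaleN1r (pairZr bb) uT // mulr0.
have t12 : 0 < t1 + t2 by exact: addr_gt0.
have wE : w = (t2 / (t1 + t2)) *: (w + t1 *: u)
    + (1 - t2 / (t1 + t2)) *: (w + t2 *: (- u)).
  have cE : t2 / (t1 + t2) * t1 = (1 - t2 / (t1 + t2)) * t2.
    by field; rewrite gt_eqF.
  by rewrite !scalerDr addrACA -scalerDl subrKC scale1r !scalerN !scalerA cE
    subrr addr0.
rewrite wE; apply: conv_hull_segment; [|exact: rec|exact: rec].
apply/andP; split; first by rewrite divr_ge0 ?ltW.
by rewrite (ler_pdivrMr _ _ t12) mul1r lerDr ltW.
Qed.

End Polar.

(** * Dirichlet approximation *)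

(** Pigeonhole: the fractional parts of k * x, for more values of k than there are
    boxes of side Q^-1 in the unit cube, put two values in the same box, and their
    difference is the required multiplier. *)
Lemma dirichlet_approximation (R : realType) (d Q : nat) (x : 'I_d -> R) :
  (0 < Q)%N -> exists k : nat, exists2 z : 'I_d -> int,
    (0 < k)%N & forall i, `|k%:R * x i - (z i)%:~R| < Q%:R^-1.
Proof.
case: Q => // Q _; pose y (k : nat) i := k%:R * x i.
pose frac (k : nat) i := Q.+1%:R * (y k i - (Num.floor (y k i))%:~R).
have frac_ge0 k i : 0 <= frac k i.
  by rewrite mulr_ge0 ?subr_ge0 ?ler0n// floor_le.
have frac_lt k i : frac k i < Q.+1%:R.
  rewrite gtr_pMr ?ltr0n// ltrBlDl -[X in _ < _ + X]/(1%:~R) -intrD.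
  exact: floorD1_gt.
pose box (k : 'I_(#|{: {ffun 'I_d -> 'I_Q.+1}}|.+1)) : {ffun 'I_d -> 'I_Q.+1} :=
  [ffun i => inord (Num.trunc (frac k i))].
have /injectivePn[k1 [k2 k12 eqbox]] : ~~ injectiveb box.
  by apply/injectiveP => /leq_card; rewrite card_ord ltnn.
wlog lt12 : k1 k2 k12 eqbox / (k1 < k2)%N.
  move=> H; have := k12; rewrite neq_ltn => /orP[|] h; first exact: (H k1 k2).
  by apply: (H k2 k1) => //; rewrite eq_sym.
exists (k2 - k1)%N, (fun i => Num.floor (y k2 i) - Num.floor (y k1 i)).
  by rewrite subn_gt0.
move=> i.
have trunc_lt k : (Num.trunc (frac k i) < Q.+1)%N.
  rewrite -(ltr_nat R); apply: le_lt_trans (frac_lt k i).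
  by have /andP[] := truncn_itv (frac_ge0 k i).
have : Num.trunc (frac k1 i) = Num.trunc (frac k2 i).
  have := congr1 (fun g : {ffun 'I_d -> 'I_Q.+1} => (g i : nat)) eqbox.
  by rewrite !ffunE !inordK.
have := truncn_itv (frac_ge0 k1 i); have := truncn_itv (frac_ge0 k2 i).
move=> + + eqt; rewrite eqt; move: (Num.trunc _) => m; rewrite -natr1.
move=> /andP[h1 h2] /andP[h3 h4]; rewrite -[ltRHS]mul1r ltr_pdivlMr ?ltr0n//.
rewrite -[X in _ * X]ger0_norm// -normrM natrB ?(ltnW lt12)//.
rewrite (_ : _ * Q.+1%:R = frac k2 i - frac k1 i); last first.
  by rewrite /frac /y intrB; ring.
by rewrite ltr_norml; lra.
Qed.

(** * Dual lattices *)

Section DualLattices.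
Context {R : realType}.

(** Two lattices with dual bases [e] and [f], each lattice being described by
    integrality against the basis of the other: this makes the data symmetric
    under exchange of the two sides. *)
Record dual_lattices (V W : vectType R) (b : V -> W -> R)
    (M : set V) (N : set W) (d : nat) (e : 'I_d -> V) (f : 'I_d -> W) : Prop := {
  dual_bilinear : bilinear_pairing b ;
  dual_orth : forall i j, b (e i) (f j) = (i == j)%:R ;
  dual_expl : forall v, v = \sum_i b v (f i) *: e i ;
  dual_expr : forall w, w = \sum_i b (e i) w *: f i ;
  dual_memM : forall v, M v <-> forall i, b v (f i) \is a Num.int ;
  dual_memN : forall w, N w <-> forall i, b (e i) w \is a Num.int }.

Lemma dual_lattices_flip (V W : vectType R) (b : V -> W -> R)
    (M : set V) (N : set W) (d : nat) (e : 'I_d -> V) (f : 'I_d -> W) :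
  dual_lattices b M N e f -> dual_lattices (flip b) N M f e.
Proof.
case=> bb eo el er eM eN; split=> //; first exact: flip_pairing.
by move=> i j; rewrite /flip eo eq_sym.
Qed.

Context {V W : vectType R} {b : V -> W -> R} {M : set V} {N : set W}.
Context {d : nat} {e : 'I_d -> V} {f : 'I_d -> W}.
Hypothesis dl : dual_lattices b M N e f.
Let bb := dual_bilinear dl.

Lemma dual_nondegenerate v : (forall w, b v w = 0) -> v = 0.
Proof.
move=> h; rewrite (dual_expl dl v) big1 // => i _.
by rewrite h scale0r.
Qed.

Lemma dual_pairE v w : b v w = \sum_i b v (f i) * b (e i) w.
Proof.
rewrite [in LHS](dual_expl dl v) (pair_suml bb).
by apply: eq_bigr => i _; rewrite (pairZl bb).
Qed.

Lemma dual_pair_int v w : M v -> N w -> b v w \is a Num.int.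
Proof.
move=> /(dual_memM dl) Mv /(dual_memN dl) Nw; rewrite dual_pairE.
by apply: rpred_sum => i _; apply: rpredM.
Qed.

Lemma dual_lattice0 : M 0.
Proof. by apply/(dual_memM dl) => i; rewrite (pair0l bb) rpred0. Qed.

(** The coordinates of the points of the hull are bounded, and those of lattice
    points are integers. *)
Lemma lattice_points_finite (s : seq V) :
  exists F : seq V, conv_hull [set` s] `&` M = [set` F].
Proof.
apply/finite_seqP.
pose S := \sum_(m <- s) \sum_i `|b m (f i)|.
have bound v i : conv_hull [set` s] v -> `|b v (f i)| <= S.
  suff : conv_hull [set` s] `<=` [set v | `|b v (f i)| <= S] by apply.
  apply: conv_hull_sub => [t x y t01 /= hx hy|m /= ms].
    move: hx hy; rewrite !ler_norml (pairDl bb) !(pairZl bb).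
    by move=> /andP[? ?] /andP[? ?]; apply/andP; split; nra.
  rewrite /S (big_rem m)//= (bigD1 i)//= -addrA lerDl.
  by rewrite addr_ge0 ?sumr_ge0// => ? _; rewrite sumr_ge0.
pose B := Num.trunc S.
have SB : S < B.+1%:R by exact: truncnS_gt.
(* coordinates in [-B-1, B+1) are shifted to naturals so as to be encoded by a
   finite type *)
pose g (z : {ffun 'I_d -> 'I_(B + B.+1).+1}) : V :=
  \sum_i ((z i)%:R - B.+1%:R) *: e i.
apply: (@sub_finite_set _ _ (range g)); last exact/finite_image/finite_finset.
move=> v [sv /(dual_memM dl) Mv].
exists [ffun i => inord (absz (Num.floor (b v (f i)) + B.+1%:Z))] => //.
rewrite /g [RHS](dual_expl dl v); apply: eq_bigr => i _; congr (_ *: _).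
have [z zE] := intrP (Mv i).
have : `|b v (f i)| < B.+1%:R by exact: le_lt_trans (bound v i sv) SB.
rewrite ffunE zE intrKfloor -intr_norm -[X in _ < X]/((Posz B.+1)%:~R).
rewrite ltr_int => zB.
rewrite inordK; last lia.
rewrite -[X in X - _]/((Posz _)%:~R) -[X in _ - X]/((Posz B.+1)%:~R) -intrB.
by congr (_%:~R); lia.
Qed.

(** Integral points of a cone cut out by integral inequalities: a lattice point
    [n] close to a multiple of [w] satisfies b m n > -1 for the finitely many
    [m], and b m n is an integer.  The multiple is taken so large that
    [n] cannot be 0. *)
Lemma lattice_point_in_cone (F : seq V) w : [set` F] `<=` M ->
  w != 0 -> (forall m, m \in F -> 0 <= b m w) ->
  exists n, [/\ N n, n != 0 & forall m, m \in F -> 0 <= b m n].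
Proof.
move=> FM w0 Fw.
have [i wi] : exists i, b (e i) w != 0.
  apply/not_existsP => h; move/eqP: w0; apply.
  rewrite (dual_expr dl w) big1 // => j _.
  by have /negP := h j; rewrite negbK => /eqP ->; rewrite scale0r.
pose S := \sum_(m <- F) \sum_i `|b m (f i)|.
have S0 : 0 <= S by rewrite sumr_ge0// => ? _; rewrite sumr_ge0.
(* c *: w has a coordinate of modulus 2, so approximating a multiple of it
   within 1 never gives 0 *)
pose c := 2 / `|b (e i) w|.
have c0 : 0 < c by rewrite divr_gt0 // normr_gt0.
have [k [z k0 kz]] := @dirichlet_approximation R d (Num.trunc S).+1
  (fun j => c * b (e j) w) isT.
set eps := _^-1 in kz.
have eps0 : 0 < eps by rewrite invr_gt0 ltr0n.
have eps1 : eps <= 1 by rewrite invf_le1 ?ltr0n// ler1n.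
have epsS : eps * S < 1.
  by rewrite mulrC ltr_pdivrMr ?ltr0n// mul1r truncnS_gt.
pose n := \sum_j (z j)%:~R *: f j.
have en j : b (e j) n = (z j)%:~R.
  rewrite (pair_sumr bb) (bigD1 j)//= big1 ?addr0 => [|l lj].
    by rewrite (pairZr bb) (dual_orth dl) eqxx mulr1.
  by rewrite (pairZr bb) (dual_orth dl) eq_sym (negPf lj) mulr0.
have Nn : N n by apply/(dual_memN dl) => j; rewrite en intr_int.
exists n; split=> //.
  apply/eqP => n0; have := en i; rewrite n0 (pair0r bb) => zi.
  have := kz i; rewrite -zi subr0 ltNge => /negP; apply.
  apply: (le_trans eps1).
  rewrite normrM normr_nat (_ : `|c * b (e i) w| = 2); last first.
    by rewrite normrM (gtr0_norm c0) divfK ?normr_eq0.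
  by rewrite -natrM ler1n muln_gt0 k0.
move=> m mF.
have bmn : b m n \is a Num.int by apply: dual_pair_int => //; exact: FM.
suff : -1 < b m n.
  move/intrP: bmn => [y ->].
  rewrite -[X in X < _]/((-1)%:~R) ltr_int ler0z.
  by lia.
have bmw : 0 <= k%:R * c * b m w.
  by rewrite mulr_ge0 ?Fw// mulr_ge0 ?ler0n ?(ltW c0).
have : `|k%:R * c * b m w - b m n| < 1; last first.
  by rewrite ltr_norml => /andP[_ h]; move: h bmw; lra.
rewrite (dual_pairE m w) (dual_pairE m n) mulr_sumr -sumrB.
apply: le_lt_trans epsS; apply: (le_trans (ler_norm_sum _ _ _)).
apply: (@le_trans _ _ (eps * \sum_j `|b m (f j)|)).
  rewrite mulr_sumr; apply: ler_sum => j _; rewrite en.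
  rewrite (_ : _ - _ = (k%:R * (c * b (e j) w) - (z j)%:~R) * b m (f j));
    last by ring.
  by rewrite normrM ler_wpM2r// ltW.
rewrite ler_pM2l// /S (big_rem m)//= lerDl.
by rewrite sumr_ge0// => ? _; rewrite sumr_ge0.
Qed.

End DualLattices.

(** * Interior points and dimension *)

Section Interior.
Context {R : realType}.

(** For convex sets, a basis-free form of having 0 as an interior point. *)
Definition absorbing (V : lmodType R) (A : set V) :=
  forall v, exists2 eps : R, 0 < eps & A (eps *: v).

Lemma vinterior0P (V : vectType R) (A : set V) :
  let e := vbasis (fullv : {vspace V}) in
  vinterior A 0 <-> exists2 eps : R, 0 < eps &
    forall y : 'rV_(\dim {:V}), (forall i, `|y 0 i| < eps) ->
    A (\sum_i y 0 i *: e`_i).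
Proof.
move=> e; have e0 : passmx.rVof e 0 = 0 by apply/rowP => i; rewrite !mxE linear0.
rewrite /vinterior /= e0 /interior; split.
  move=> /nbhs_ballP[eps /= eps0 h]; exists eps => // y yeps.
  apply: (h y); split=> // i j; rewrite ord1 -ball_normE /= mxE sub0r normrN.
  exact: yeps.
move=> [eps eps0 h]; apply/nbhs_ballP; exists eps => //= y [_ hy].
apply: h => i; have := hy 0 i.
by rewrite -ball_normE /= mxE sub0r normrN.
Qed.

Lemma vinterior0_absorbing (V : vectType R) (A : set V) :
  vinterior A 0 -> absorbing A.
Proof.
move=> /vinterior0P[eps eps0 h] v; set e := vbasis _ in h.
pose S := \sum_i `|coord e i v|.
have S0 : 0 <= S by exact: sumr_ge0.
exists (eps / (S + 1)); first by rewrite divr_gt0 // ltr_wpDl.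
have -> : (eps / (S + 1)) *: v
    = \sum_i (\row_i (eps / (S + 1) * coord e i v)) 0 i *: e`_i.
  rewrite [in LHS](coord_basis (vbasisP fullv) (memvf v)) scaler_sumr.
  by apply: eq_bigr => i _; rewrite mxE scalerA.
apply: h => i; rewrite mxE normrM (gtr0_norm (divr_gt0 _ _)) ?ltr_wpDl//.
rewrite mulrAC ltr_pdivrMr ?ltr_wpDl// ltr_pM2l//.
by rewrite /S (bigD1 i)//= -addrA ltrDl ltr_wpDl // sumr_ge0.
Qed.

Lemma polar_finite_vinterior (V W : vectType R) (b : V -> W -> R) (F : seq V) :
  bilinear_pairing b -> vinterior (polar b [set` F]) 0.
Proof.
move=> bb; apply/vinterior0P; set e := vbasis _.
pose S := \sum_(m <- F) \sum_(i < \dim {:W}) `|b m e`_i|.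
have S0 : 0 <= S by rewrite sumr_ge0// => ? _; rewrite sumr_ge0.
have S1 : 0 < S + 1 by rewrite ltr_wpDl.
exists (S + 1)^-1 => [|y yS m /= mF]; first by rewrite invr_gt0.
suff : `|b m (\sum_i y 0 i *: e`_i)| <= 1 by rewrite ler_norml => /andP[].
rewrite (pair_sumr bb); apply: (le_trans (ler_norm_sum _ _ _)).
apply: (@le_trans _ _ (\sum_(i < \dim {:W}) (S + 1)^-1 * `|b m e`_i|)).
  apply: ler_sum => i _; rewrite (pairZr bb) normrM ler_wpM2r//.
  exact/ltW/yS.
rewrite -mulr_sumr mulrC ler_pdivrMr // mul1r.
rewrite /S (big_rem m)//= -addrA lerDl addr_ge0// sumr_ge0// => ? _.
exact: sumr_ge0.
Qed.

(** The direction space of the affine span contains [x0], because 0 is in the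
    hull, and thus contains the whole hull; as the hull meets every ray from 0,
    it is everything. *)
Lemma absorbing_polytope (V : vectType R) (s : seq V) :
  conv_hull [set` s] 0 -> absorbing (conv_hull [set` s]) ->
  is_polytope (\dim {:V}) (conv_hull [set` s]).
Proof.
case: s => [|x0 s] s0 sabs.
  suff : (set0 : set V) 0 by [].
  by move: s0; apply: conv_hull_sub.
exists x0, s; split=> //; congr (\dim _); apply/eqP.
rewrite eqEsubv subvf /=; apply/subvP => v _.
set U := (<<_>>)%VS.
have hullU x : conv_hull [set` x0 :: s] x -> x - x0 \in U.
  suff : conv_hull [set` x0 :: s] `<=` [set x | x - x0 \in U] by apply.
  apply: conv_hull_sub => [t y z _ /= yU zU|y /=].
    have -> : t *: y + (1 - t) *: z - x0 = t *: (y - x0) + (1 - t) *: (z - x0).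
      by rewrite !scalerBr addrACA -opprD -scalerDl subrKC scale1r.
    by rewrite rpredD// rpredZ.
  rewrite inE => /predU1P[->|ys]; first by rewrite subrr rpred0.
  by apply: memv_span; apply/mapP; exists y.
have x0U : x0 \in U by rewrite -rpredN -sub0r; exact: hullU.
have [eps eps0 /hullU vU] := sabs v.
have : eps *: v \in U by rewrite -(rpredBr _ x0U).
by rewrite rpredZeq gt_eqF.
Qed.

End Interior.

(** * Duality of Q-reflexive polytopes *)

Section Duality.
Context {R : realType} {V W : vectType R} {b : V -> W -> R}.
Context {M : set V} {N : set W} {d : nat} {e : 'I_d -> V} {f : 'I_d -> W}.
Hypothesis dl : dual_lattices b M N e f.
Let bb := dual_bilinear dl.

(** The dual polytope is bounded: otherwise it would contain all the multiples of
    some nonzero lattice point, hence so would the polar of [D], which is bounded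
    because [D] is absorbing. *)
Lemma Qreflexive_no_recession (D : set V) (F : seq V) : absorbing D ->
  D `&` M = [set` F] ->
  conv_hull (circ b M D `&` N) = polar b D ->
  forall w, (forall m, m \in F -> 0 <= b m w) -> w = 0.
Proof.
move=> Dabs DM polD w wF; apply/eqP/negPn/negP => w0.
have FM : [set` F] `<=` M by rewrite -DM => ? [].
have [n [Nn n0 nF]] := lattice_point_in_cone dl FM w0 wF.
have multiples (k : nat) : polar b D (k%:R *: n).
  rewrite -polD; apply: sub_conv_hull; split.
    rewrite /circ (polar_conv_hull bb) DM => m mF; rewrite (pairZr bb).
    by apply: le_trans (lerN10 _) _; rewrite mulr_ge0 ?ler0n// nF.
  apply/(dual_memN dl) => i; rewrite (pairZr bb) rpredM ?natr_int//.
  by move/(dual_memN dl): Nn; exact.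
have [v vn] : exists v, b v n != 0.
  apply/not_existsP => h; move/eqP: n0; apply.
  apply: (dual_nondegenerate (dual_lattices_flip dl)) => v.
  by have /negP := h v; rewrite negbK => /eqP.
wlog {vn} vn : v / b v n < 0.
  move=> H; have [/H //|h] := ltP (b v n) 0.
  apply: (H (-1 *: v)); rewrite (pairZl bb) mulN1r ?oppr_eq0 // oppr_lt0.
  by rewrite lt_def vn.
have [eps eps0 Dv] := Dabs v.
(* k > (eps * - b v n)^-1 makes k * eps * b v n < -1 *)
have := multiples (Num.trunc (eps * - b v n)^-1).+1 _ Dv.
rewrite (pairZr bb) (pairZl bb) leNgt => /negP; apply.
rewrite ltrNr -mulrN -mulrN -ltr_pdivrMr ?mulr_gt0 ?oppr_gt0//.
by rewrite mul1r truncnS_gt.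
Qed.

Theorem Qreflexive_circ (D : set V) : Qreflexive b M N D ->
  Qreflexive (flip b) N M (circ b M D) /\
  circ (flip b) N (circ b M D) = D.
Proof.
move=> [[x0 [s [DE _]]] Dint polD].
have Dabs := vinterior0_absorbing Dint.
have D0 : D 0 by have [eps _] := Dabs 0; rewrite scaler0.
have [F] := lattice_points_finite dl (x0 :: s); rewrite -DE => DM.
have nd := dual_nondegenerate dl.
have circE : circ b M D = polar b [set` F] by rewrite /circ DM polar_conv_hull.
have [t tE] := polar_finite_conv bb (Qreflexive_no_recession Dabs DM polD).
have cint : vinterior (circ b M D) 0.
  by rewrite circE; exact: polar_finite_vinterior.
have c0 : circ b M D 0.
  by have [eps _] := vinterior0_absorbing cint 0; rewrite scaler0.
have circK : circ (flip b) N (circ b M D) = D.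
  rewrite /circ -/(circ b M D) polD DE (polar_conv_hull bb) bipolar_conv//.
  by rewrite -DE.
have F0 : conv_hull [set` F] 0.
  by apply: sub_conv_hull; rewrite -DM; split=> //; exact: dual_lattice0 dl.
split=> //; split=> //.
  rewrite circE tE in cint c0 *.
  by apply: absorbing_polytope => //; exact: vinterior0_absorbing.
by rewrite circK DM circE (bipolar_conv bb nd F0).
Qed.

End Duality.

(** The forms of the dual basis are the coordinate functions of a basis of the
    lattice. *)
Lemma dual_lattice_dual_lattices (R : realType) (d : nat) (V : vectType R)
    (M : set V) : is_lattice d M ->
  exists (e : 'I_d -> V) (f : 'I_d -> 'Hom(V, R^o)),
    dual_lattices pairing M (dual_lattice M) e f.
Proof.
move=> [e be ME]; exists (fun i => e`_i), (fun i => linfun (coord e i)).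
have fE i v : pairing v (linfun (coord e i)) = coord e i v.
  by rewrite /pairing lfunE.
have bb : @bilinear_pairing R V 'Hom(V, R^o) pairing.
  split=> [a x y w|a v x y]; rewrite /pairing; first by rewrite linearP.
  by rewrite add_lfunE scale_lfunE.
have el v : v = \sum_i coord e i v *: e`_i by exact: coord_basis be (memvf v).
have fr := basis_free be.
split=> //.
- by move=> i j; rewrite fE coord_free.
- by move=> v; rewrite [LHS]el; apply: eq_bigr => i _; rewrite fE.
- move=> w; apply/lfunP => v; rewrite [in LHS](el v) linear_sum sum_lfunE /=.
  apply: eq_bigr => i _; rewrite linearZ scale_lfunE lfunE /=.
  by rewrite /pairing /GRing.scale /= mulrC.
- move=> v; rewrite ME; split=> [[z _ <-] i|vz].
    rewrite fE linear_sum /= (bigD1 i)//= big1 ?addr0 => [|j ji].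
      by rewrite raddfMz /= coord_free // eqxx intr_int.
    by rewrite raddfMz /= coord_free // (negPf ji) mul0rz.
  exists (fun i => Num.floor (coord e i v)) => //.
  rewrite [RHS]el; apply: eq_bigr => i _.
  by rewrite -scaler_int floorK // -fE; exact: vz.
move=> w; split=> [Nw i|wz m].
  apply: Nw; rewrite ME; exists (fun j => (j == i)%:Z) => //.
  rewrite (bigD1 i)//= eqxx mulr1z big1 ?addr0 // => j ji.
  by rewrite (negPf ji) mulr0z.
rewrite ME => -[z _ <-]; rewrite linear_sum; apply: rpred_sum => i _.
by rewrite raddfMz /= rpredMz //; exact: wz.
Qed.

Theorem lemma1p8 (R : realType) (d : nat) (V : vectType R) (M : set V)
    (latM : is_lattice d M) :
  let N := dual_lattice M in
  (forall D : set V, Qreflexive pairing M N D ->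
     Qreflexive copairing N M (circ pairing M D) /\
     circ copairing N (circ pairing M D) = D) /\
  (forall D' : set 'Hom(V, R^o), Qreflexive copairing N M D' ->
     Qreflexive pairing M N (circ copairing N D') /\
     circ pairing M (circ copairing N D') = D').
Proof.
have [e [f dl]] := dual_lattice_dual_lattices latM.
move=> N; split; first exact: Qreflexive_circ dl.
exact: Qreflexive_circ (dual_lattices_flip dl).
Qed.
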